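(* (i) Let $n=2m$ with $m\geq 3$. There exist a linear connection $\nabla$ on $\mathbb{R}^n$ having an irreducible holonomy group and two independent semi-Riemannian metrics on $\mathbb{R}^n$ of signature $(m,m)$, both parallel with respect to $\nabla$. (ii) Let $n=2m$, $m=2r$ with $r\geq 2$. There exist a linear connection $\nabla$ on $\mathbb{R}^n$ having an irreducible holonomy group and three independent semi-Riemannian metrics on $\mathbb{R}^n$ of signature $(m,m)$, all parallel with respect to $\nabla$.
   Context: $\mathbb{R}^n$ is regarded as a smooth manifold. A linear connection is a connection on the tangent bundle; it is not assumed to be symmetric (torsion-free). A semi-Riemannian metric is a smooth symmetric nondegenerate $(0,2)$-tensor field; it is parallel with respect to $\nabla$ if $\nabla g=0$. Metrics are independent if they are linearly independent over $\mathbb{R}$ as tensor fields. The holonomy group $\Psi(x)\subseteq \mathrm{Aut}(T_xM)$ of $\nabla$ at a point $x$ of a connected manifold $M$ is the group of parallel translations around all piecewise smooth loops based at $x$. It is irreducible if it has no invariant real subspace of $T_xM$ other than $0$ and $T_xM$; this is independent of the choice of $x$. *)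

(* Defs.v *)
From HB Require Import structures.
From mathcomp Require Import all_boot all_order all_algebra.
From mathcomp Require Import all_classical all_reals all_analysis.
Set Implicit Arguments.
Unset Strict Implicit.
Unset Printing Implicit Defensive.
Import Order.TTheory GRing.Theory Num.Theory.
Import numFieldNormedType.Exports.
Local Open Scope classical_set_scope.
Local Open Scope ring_scope.

(* Points of R^n and tangent vectors are row vectors, so an endomorphism of a
   tangent space is a matrix acting on the right: v |-> v *m A. *)

(* On a finite-dimensional V this is the usual notion of a C^k map: all
   iterated directional derivatives up to order k exist and are continuous. *)
Fixpoint Ck (R : realType) (V W : normedModType R) (k : nat) (f : V -> W) :
    Prop :=
  match k with
  | 0 => continuous f
  | k'.+1 => (forall x, differentiable f x) /\ forall v, Ck k' ('D_v f)
  end.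

Definition smooth (R : realType) (V W : normedModType R) (f : V -> W) : Prop :=
  forall k, Ck k f.

(* Covariant derivative on the tangent bundle, not assumed torsion-free.
   Vector fields are maps R^n -> R^n; nabla is only constrained on the smooth
   ones. R-linearity in the second argument is conn_addr together with
   conn_leibniz for constant f. *)
Record linear_connection (R : realType) (n : nat) := LinearConnection {
  conn :> ('rV[R]_n -> 'rV[R]_n) -> ('rV[R]_n -> 'rV[R]_n) ->
          'rV[R]_n -> 'rV[R]_n;
  conn_smooth : forall X Y, smooth X -> smooth Y -> smooth (conn X Y);
  conn_addl : forall X X' Y, smooth X -> smooth X' -> smooth Y ->
    forall x, conn (fun y => X y + X' y) Y x = conn X Y x + conn X' Y x;
  conn_scalel : forall (f : 'rV[R]_n -> R) X Y,
    smooth f -> smooth X -> smooth Y ->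
    forall x, conn (fun y => f y *: X y) Y x = f x *: conn X Y x;
  conn_addr : forall X Y Y', smooth X -> smooth Y -> smooth Y' ->
    forall x, conn X (fun y => Y y + Y' y) x = conn X Y x + conn X Y' x;
  conn_leibniz : forall (f : 'rV[R]_n -> R) X Y,
    smooth f -> smooth X -> smooth Y ->
    forall x, conn X (fun y => f y *: Y y) x =
              'D_(X x) f x *: Y x + f x *: conn X Y x
}.

(* Gamma_x(v, w), the bilinear map given by the Christoffel symbols of nabla in
   the standard frame: Gamma_x(e_i, e_j) = (nabla_{e_i} e_j)(x). *)
Definition christoffel (R : realType) (n : nat) (nabla : linear_connection R n)
    (x v w : 'rV[R]_n) : 'rV[R]_n :=
  \sum_(i < n) \sum_(j < n) (v 0 i * w 0 j) *:
    nabla (fun=> delta_mx 0 i) (fun=> delta_mx 0 j) x.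

Definition subdivision (R : realType) (t : seq R) : Prop :=
  [/\ sorted <%R t, head 0 t = 0 & last 0 t = 1].

(* A curve [0, 1] -> R^n is a map on R of which only the values on [0, 1]
   matter; it is smooth on a closed interval when it extends from there to a
   smooth map on R. Agreement at the subdivision points makes a piecewise smooth
   curve continuous on [0, 1]. *)
Definition piecewise_smooth (R : realType) (n : nat) (t : seq R)
    (c : R -> 'rV[R]_n) : Prop :=
  forall i, (i.+1 < size t)%N ->
    exists2 h : R -> 'rV[R]_n, smooth h & {in `[t`_i, t`_i.+1], c =1 h}.

(* V' + Gamma_c(c', V) = 0 off the subdivision points, V continuous across. *)
Definition parallel_along (R : realType) (n : nat)
    (nabla : linear_connection R n) (t : seq R) (c V : R -> 'rV[R]_n) : Prop :=
  {within `[0, 1], continuous V} /\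
  forall i, (i.+1 < size t)%N -> forall u, u \in `]t`_i, t`_i.+1[ ->
    is_derive u 1 V (- christoffel nabla (c u) ('D_1 c u) (V u)).

(* The automorphisms v |-> v *m A of T_x R^n arising as parallel translation
   around a piecewise smooth loop at x. *)
Definition holonomy (R : realType) (n : nat) (nabla : linear_connection R n)
    (x : 'rV[R]_n) : set 'M[R]_n :=
  [set A | A \in unitmx /\
    exists (t : seq R) (c : R -> 'rV[R]_n),
      [/\ subdivision t, piecewise_smooth t c, c 0 = x, c 1 = x &
          forall v, exists V : R -> 'rV[R]_n,
            [/\ parallel_along nabla t c V, V 0 = v & V 1 = v *m A]]].

Definition irreducible_set (R : realType) (n : nat) (G : set 'M[R]_n) : Prop :=
  forall W : {vspace 'rV[R]_n},
    (forall A, G A -> forall v, v \in W -> v *m A \in W) ->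
    W = 0%VS \/ W = fullv.

Definition irreducible_holonomy (R : realType) (n : nat)
    (nabla : linear_connection R n) : Prop :=
  forall x, irreducible_set (holonomy nabla x).

(* A (0,2)-tensor field on R^n, given by its matrix of components. *)
Definition tensor_eval (R : realType) (n : nat) (g : 'rV[R]_n -> 'M[R]_n)
    (X Y : 'rV[R]_n -> 'rV[R]_n) : 'rV[R]_n -> R :=
  fun x => (X x *m g x *m (Y x)^T) 0 0.

Definition semi_riemannian (R : realType) (n : nat)
    (g : 'rV[R]_n -> 'M[R]_n) : Prop :=
  [/\ smooth g, forall x, (g x)^T = g x & forall x, g x \in unitmx].

(* Every tangent space has an orthonormal basis (the rows of P) consisting of
   p vectors of square 1 and q vectors of square -1. *)
Definition has_signature (R : realType) (n : nat) (g : 'rV[R]_n -> 'M[R]_n)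
    (p q : nat) : Prop :=
  (p + q)%N = n /\
  forall x, exists2 P : 'M[R]_n, P \in unitmx &
    P *m g x *m P^T = diag_mx (\row_(i < n) (if (i < p)%N then 1 else -1)).

(* nabla g = 0, i.e. X (g(Y, Z)) = g(nabla_X Y, Z) + g(Y, nabla_X Z). *)
Definition parallel_tensor (R : realType) (n : nat)
    (nabla : linear_connection R n) (g : 'rV[R]_n -> 'M[R]_n) : Prop :=
  forall X Y Z : 'rV[R]_n -> 'rV[R]_n, smooth X -> smooth Y -> smooth Z ->
    forall x, 'D_(X x) (tensor_eval g Y Z) x =
      tensor_eval g (nabla X Y) Z x + tensor_eval g Y (nabla X Z) x.

Definition independent (R : realType) (n k : nat)
    (g : 'I_k -> 'rV[R]_n -> 'M[R]_n) : Prop :=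
  forall a : 'I_k -> R,
    (forall x, \sum_(i < k) a i *: g i x = 0) -> forall i, a i = 0.

(* Main.v *)
(* On R^n = C^m take a constant complex bilinear form; its real and imaginary
   parts are two metrics of signature (m, m), both preserved by so(m, C).  On
   R^n = H^r the three imaginary components of a skew-Hermitian form are
   preserved by so*(2r).  The connection form is x_0 * sum_k A_k dx_k with
   constant matrices A_k of the Lie algebra and A_0 = 0.  In a plane parallel to
   e_0 and e_k it takes values in the line through A_k, so a loop there has
   holonomy exp(s A_k) with s the enclosed area, and every s occurs.  All the
   A_k satisfy A_k^3 = A_k or A_k^3 = - A_k, so exp(s A_k) - exp(- s A_k) is a
   nonzero multiple of A_k for a suitable s, and a holonomy-invariant subspace
   is invariant under the algebra generated by the A_k.  Taking for them
   E_0a - E_a0 times suitable scalars, and in the quaternionic case also j E_aa,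
   this algebra contains all complex, respectively quaternionic, matrices. *)
Require Import Defs.
From mathcomp Require Import all_boot all_order all_algebra.
From mathcomp Require Import all_classical all_reals all_analysis.
From mathcomp Require Import ring lra.
Set Implicit Arguments.
Unset Strict Implicit.
Unset Printing Implicit Defensive.
Import Order.TTheory GRing.Theory Num.Theory.
Import numFieldNormedType.Exports.
Local Open Scope classical_set_scope.
Local Open Scope ring_scope.

(** * Smooth maps *)

Section Smoothness.
Context {R : realType} {V : normedModType R}.

Lemma Ck_continuous (W : normedModType R) k (f : V -> W) :
  Ck k f -> continuous f.
Proof.
by case: k => // k [df _] x; exact: differentiable_continuous (df x).
Qed.

Lemma CkW (W : normedModType R) k (f : V -> W) : Ck k.+1 f -> Ck k f.
Proof.
elim: k f => [|k IHk] f; first exact: Ck_continuous.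
by case=> df Df; split => // v; exact/IHk/Df.
Qed.

Lemma smooth_differentiable (W : normedModType R) (f : V -> W) x :
  smooth f -> differentiable f x.
Proof. by move=> /(_ 1%N) [df _]; exact: df. Qed.

Lemma smooth_derivable (W : normedModType R) (f : V -> W) x v :
  smooth f -> derivable f x v.
Proof. by move=> sf; apply: diff_derivable; exact: smooth_differentiable. Qed.

Lemma smooth_derive (W : normedModType R) (f : V -> W) v :
  smooth f -> smooth ('D_v f).
Proof. by move=> sf k; have [_ Df] := sf k.+1; exact: Df. Qed.

Lemma smooth_cst (W : normedModType R) (w : W) : smooth (fun _ : V => w).
Proof.
move=> k; elim: k w => [|k IHk] w; first exact: cst_continuous.
split=> [x|v]; first exact: differentiable_cst.
rewrite (_ : 'D_v _ = fun=> 0); first exact: IHk.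
by apply/funext => x; exact: derive_cst.
Qed.

Lemma CkD (W : normedModType R) k (f g : V -> W) :
  Ck k f -> Ck k g -> Ck k (fun x => f x + g x).
Proof.
elim: k f g => [|k IHk] f g.
  by move=> cf cg x; apply: continuousD; [exact: cf|exact: cg].
move=> [df Df] [dg Dg]; split=> [x|v]; first exact: differentiableD.
rewrite (_ : 'D_v _ = fun x => 'D_v f x + 'D_v g x).
  by apply: IHk; [exact: Df|exact: Dg].
by apply/funext => x; rewrite deriveD //; exact: diff_derivable.
Qed.

Lemma smoothD (W : normedModType R) (f g : V -> W) :
  smooth f -> smooth g -> smooth (fun x => f x + g x).
Proof. by move=> sf sg k; apply: CkD; [exact: sf|exact: sg]. Qed.

Lemma smooth_sum (W : normedModType R) n (f : 'I_n -> V -> W) :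
  (forall i, smooth (f i)) -> smooth (fun x => \sum_i f i x).
Proof.
move=> sf; elim: n f sf => [|n IHn] f sf.
  rewrite (_ : (fun x => _) = fun=> 0); first exact: smooth_cst.
  by apply/funext => x; rewrite big_ord0.
rewrite (_ : (fun x => _) = fun x => f ord0 x + \sum_i f (lift ord0 i) x).
  by apply: smoothD => //; exact: IHn.
by apply/funext => x; rewrite big_ord_recl.
Qed.

(** Induction on the order, for all factors at once: the Leibniz rule turns the derivative into a
    sum of products in which one factor is undifferentiated, and [CkW] lowers its order. *)
Lemma smoothM (f g : V -> R) :
  smooth f -> smooth g -> smooth (fun x => f x * g x).
Proof.
move=> sf sg k; move: (sf k) (sg k) => {sf sg}.
elim: k f g => [|k IHk] f g.
  by move=> cf cg x; apply: continuousM; [exact: cf|exact: cg].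
move=> Cf Cg; move: (Cf) (Cg) => [df Df] [dg Dg].
split=> [x|v]; first exact: differentiableM.
rewrite (_ : 'D_v _ = fun x => f x * 'D_v g x + g x * 'D_v f x); last first.
  by apply/funext => x; rewrite deriveM //; exact: diff_derivable.
by apply: CkD; apply: IHk; [exact: CkW|exact: Dg|exact: CkW|exact: Df].
Qed.

Lemma smoothZl (W : normedModType R) (f : V -> R) (w : W) :
  smooth f -> smooth (fun x => f x *: w).
Proof.
move=> sf k; move: (sf k) => {sf}.
elim: k f => [|k IHk] f.
  move=> cf x; apply: (@continuous_comp _ _ _ f ( *:%R^~ w)); first exact: cf.
  exact: scalel_continuous.
move=> [df Df]; split=> [x|v]; first exact: differentiableZl.
rewrite (_ : 'D_v _ = fun x => 'D_v f x *: w); first by apply: IHk; exact: Df.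
apply/funext => x; rewrite deriveE ?diffZl -?deriveE //.
exact: differentiableZl.
Qed.

Lemma smooth_linear_comp (W W' : normedModType R) (L : {linear W -> W'})
    (f : V -> W) : continuous L -> smooth f -> smooth (fun x => L (f x)).
Proof.
move=> cL sf k; move: (sf k) => {sf}.
elim: k f => [|k IHk] f.
  by move=> cf x; apply: (@continuous_comp _ _ _ f L); [exact: cf|exact: cL].
move=> [df Df].
have dL y : differentiable L y by exact: linear_differentiable.
split=> [x|v]; first exact: differentiable_comp.
rewrite (_ : 'D_v _ = fun x => L ('D_v f x)); first by apply: IHk; exact: Df.
apply/funext => x; rewrite deriveE; last exact: differentiable_comp.
by rewrite (@diff_comp _ _ _ _ f L) //= diff_lin // deriveE.
Qed.

Lemma smooth_id : smooth (@idfun V).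
Proof.
case=> [|k]; first by move=> x.
split=> [x|v]; first exact: ex_diff.
rewrite (_ : 'D_v _ = fun=> v); first exact: smooth_cst.
by apply/funext => x; rewrite derive_id.
Qed.

Lemma smooth_coord n (f : V -> 'rV[R]_n) j :
  smooth f -> smooth (fun x => f x 0 j).
Proof.
have @L : {linear 'rV[R]_n -> R}.
  by exists (fun N : 'rV[R]_n => N 0 j); do 2![eexists]; do ?[constructor];
     rewrite ?mxE// => ? *; rewrite ?mxE//; move=> ?; rewrite !mxE.
by apply: (smooth_linear_comp (L := L)); exact: coord_continuous.
Qed.

Lemma smooth_row n (f : V -> 'rV[R]_n) :
  (forall j, smooth (fun x => f x 0 j)) -> smooth f.
Proof.
move=> sf; rewrite (_ : f = fun x => \sum_j f x 0 j *: delta_mx 0 j).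
  by apply: smooth_sum => j; exact: smoothZl.
by apply/funext => x; exact: row_sum_delta.
Qed.

Lemma smooth_scale n (f : V -> R) (g : V -> 'rV[R]_n) :
  smooth f -> smooth g -> smooth (fun x => f x *: g x).
Proof.
move=> sf sg; apply: smooth_row => j.
under eq_fun do rewrite mxE.
by apply: smoothM => //; exact: smooth_coord.
Qed.

Lemma smooth_mulmx m n (f : V -> 'rV[R]_m) (A : 'M[R]_(m, n)) :
  smooth f -> smooth (fun x => f x *m A).
Proof.
move=> sf; apply: smooth_row => j.
under eq_fun do rewrite mxE.
apply: smooth_sum => i; apply: smoothM; first exact: smooth_coord.
exact: smooth_cst.
Qed.

(** * Derivatives of matrix-valued maps *)

Lemma is_derive_mx m n (M : V -> 'M[R]_(m, n)) (dM : 'M[R]_(m, n)) x v :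
  (forall i j, is_derive x v (fun y => M y i j) (dM i j)) ->
  is_derive x v M dM.
Proof.
move=> dMij; have MP : derivable M x v.
  by apply/derivable_mxP => i j; case: (dMij i j).
apply: DeriveDef => //; rewrite derive_mx //.
by apply/matrixP => i j; rewrite mxE; case: (dMij i j).
Qed.

Lemma is_derive_mxE m n (M : V -> 'M[R]_(m, n)) (dM : 'M[R]_(m, n)) x v i j :
  is_derive x v M dM -> is_derive x v (fun y => M y i j) (dM i j).
Proof.
move=> [MP <-]; rewrite derive_mx // mxE.
by apply: derivableP; move/derivable_mxP: MP; exact.
Qed.

Lemma is_derive_sumE (W : normedModType R) n (h : 'I_n -> V -> W) dh x v :
  (forall i, is_derive x v (h i) (dh i)) ->
  is_derive x v (fun y => \sum_(i < n) h i y) (\sum_(i < n) dh i).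
Proof.
move=> dhi; rewrite (_ : (fun y => _) = \sum_(i < n) h i).
  exact: is_derive_sum.
by apply/funext => y; rewrite fct_sumE.
Qed.

Lemma is_derive_mulmx m n p (M : V -> 'M[R]_(m, n)) (N : V -> 'M[R]_(n, p))
    (dM : 'M[R]_(m, n)) (dN : 'M[R]_(n, p)) x v :
  is_derive x v M dM -> is_derive x v N dN ->
  is_derive x v (fun y => M y *m N y) (dM *m N x + M x *m dN).
Proof.
move=> dMx dNx; apply: is_derive_mx => i j.
under eq_fun do rewrite mxE.
have H k : is_derive x v (fun y => M y i k * N y k j)
    (M x i k * dN k j + N x k j * dM i k).
  by apply: is_deriveM; exact: is_derive_mxE.
apply: is_derive_eq; first exact: is_derive_sumE H.
rewrite !mxE -big_split /=; apply: eq_bigr => k _.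
by rewrite addrC [N x k j * _]mulrC.
Qed.

Lemma is_derive_scale m n (f : V -> R) (M : V -> 'M[R]_(m, n)) df
    (dM : 'M[R]_(m, n)) x v :
  is_derive x v f df -> is_derive x v M dM ->
  is_derive x v (fun y => f y *: M y) (df *: M x + f x *: dM).
Proof.
move=> dfx dMx; apply: is_derive_mx => i j.
under eq_fun do rewrite mxE.
apply: is_derive_eq.
  by apply: (@is_deriveM _ _ f (fun y => M y i j)); exact: is_derive_mxE.
by rewrite !mxE addrC [M x i j *: _]mulrC.
Qed.

End Smoothness.

(** * A connection with explicit holonomy *)

Section PlanarConnection.
Context {R : realType} {n : nat}.
Variables (i0 : 'I_n) (A : 'I_n -> 'M[R]_n).

(** The factor [x 0 i0] makes the curvature on the directions of [i0] and [k] equal to the constant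
    matrix [A k], up to sign, once [A i0 = 0]. *)
Definition planar_form (x v : 'rV[R]_n) : 'M[R]_n :=
  x 0 i0 *: \sum_k v 0 k *: A k.

Definition planar_conn (X Y : 'rV[R]_n -> 'rV[R]_n) (x : 'rV[R]_n) : 'rV[R]_n :=
  'D_(X x) Y x + Y x *m planar_form x (X x).

Lemma planar_formD x v w :
  planar_form x (v + w) = planar_form x v + planar_form x w.
Proof.
rewrite /planar_form -scalerDr -big_split; congr (_ *: _).
by apply: eq_bigr => k _; rewrite mxE scalerDl.
Qed.

Lemma planar_formZ x a v : planar_form x (a *: v) = a *: planar_form x v.
Proof.
rewrite /planar_form scalerA mulrC -scalerA; congr (_ *: _).
by rewrite scaler_sumr; apply: eq_bigr => k _; rewrite mxE scalerA.
Qed.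

Lemma planar_form_delta x k : planar_form x (delta_mx 0 k) = x 0 i0 *: A k.
Proof.
rewrite /planar_form (bigD1 k) //= big1 ?addr0 ?mxE ?eqxx ?scale1r // => j jk.
by rewrite mxE eqxx (negbTE jk) scale0r.
Qed.

Lemma planar_conn_smooth X Y :
  smooth X -> smooth Y -> smooth (planar_conn X Y).
Proof.
move=> sX sY.
(* Smoothness of derivatives is known for fixed directions only, so the varying direction [X x] is
   expanded in the standard basis. *)
rewrite (_ : planar_conn X Y = fun x =>
    \sum_k X x 0 k *: 'D_(delta_mx 0 k) Y x +
    \sum_k (x 0 i0 * X x 0 k) *: (Y x *m A k)).
  apply: smoothD; apply: smooth_sum => k; apply: smooth_scale.
  - exact: smooth_coord.
  - exact: smooth_derive.
  - apply: smoothM; last exact: smooth_coord.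
    by apply: (@smooth_coord _ _ _ id); apply: smooth_id.
  - exact: smooth_mulmx.
apply/funext => x; rewrite /planar_conn; congr (_ + _).
  have dY := smooth_differentiable x sY.
  rewrite deriveE // {1}[X x]row_sum_delta linear_sum.
  by apply: eq_bigr => k _; rewrite linearZ deriveE.
rewrite -scalemxAr mulmx_sumr scaler_sumr.
by apply: eq_bigr => k _; rewrite -scalemxAr scalerA.
Qed.

Lemma planar_conn_addl X X' Y : smooth X -> smooth X' -> smooth Y ->
  forall x, planar_conn (fun y => X y + X' y) Y x =
    planar_conn X Y x + planar_conn X' Y x.
Proof.
move=> sX sX' sY x; have dY := smooth_differentiable x sY.
by rewrite /planar_conn planar_formD mulmxDr !deriveE // linearD addrACA.
Qed.

Lemma planar_conn_scalel (f : 'rV[R]_n -> R) X Y :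
  smooth f -> smooth X -> smooth Y ->
  forall x, planar_conn (fun y => f y *: X y) Y x = f x *: planar_conn X Y x.
Proof.
move=> sf sX sY x; have dY := smooth_differentiable x sY.
by rewrite /planar_conn planar_formZ -scalemxAr !deriveE // linearZ scalerDr.
Qed.

Lemma planar_conn_addr X Y Y' : smooth X -> smooth Y -> smooth Y' ->
  forall x, planar_conn X (fun y => Y y + Y' y) x =
    planar_conn X Y x + planar_conn X Y' x.
Proof.
move=> sX sY sY' x; rewrite /planar_conn mulmxDl addrACA; congr (_ + _).
by rewrite -deriveD //; exact: smooth_derivable.
Qed.

Lemma planar_conn_leibniz (f : 'rV[R]_n -> R) X Y :
  smooth f -> smooth X -> smooth Y ->
  forall x, planar_conn X (fun y => f y *: Y y) x =
    'D_(X x) f x *: Y x + f x *: planar_conn X Y x.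
Proof.
move=> sf sX sY x.
have dfY : is_derive x (X x) (fun y => f y *: Y y)
    ('D_(X x) f x *: Y x + f x *: 'D_(X x) Y x).
  by apply: is_derive_scale; apply: derivableP; exact: smooth_derivable.
by rewrite /planar_conn derive_val -scalemxAl scalerDr addrA.
Qed.

Definition planar_connection : linear_connection R n :=
  LinearConnection planar_conn_smooth planar_conn_addl planar_conn_scalel
    planar_conn_addr planar_conn_leibniz.

(** The standard frame is constant, so only the zeroth-order term of the connection contributes. *)
Lemma planar_christoffel x v w :
  christoffel planar_connection x v w = w *m planar_form x v.
Proof.
rewrite /christoffel /= /planar_conn exchange_big [in RHS](row_sum_delta w).
rewrite mulmx_suml; apply: eq_bigr => j _.
rewrite -scalemxAl -scalemxAr mulmx_sumr !scaler_sumr; apply: eq_bigr => i _.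
rewrite derive_cst add0r planar_form_delta -!scalemxAr !scalerA.
by congr (_ *: _); ring.
Qed.

(** The hypothesis puts every [A k] in the Lie algebra of the orthogonal group of [G], hence also
    the values of the connection form. As [G] is constant, the Leibniz rule leaves just this skew
    term. *)
Lemma planar_parallel (G : 'M[R]_n) :
  (forall k, A k *m G + G *m (A k)^T = 0) ->
  parallel_tensor planar_connection (fun=> G).
Proof.
move=> skewA X Y Z sX sY sZ x.
have skew v : planar_form x v *m G + G *m (planar_form x v)^T = 0.
  rewrite /planar_form linearZ /= -scalemxAl -scalemxAr -scalerDr.
  rewrite linear_sum /= mulmx_suml mulmx_sumr -big_split big1 ?scaler0 // => k _.
  by rewrite linearZ /= -scalemxAl -scalemxAr -scalerDr skewA scaler0.
have dY : is_derive x (X x) Y ('D_(X x) Y x).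
  by apply: derivableP; exact: smooth_derivable.
have dZ : is_derive x (X x) (fun y => (Z y)^T) ('D_(X x) Z x)^T.
  apply: is_derive_mx => i j; under eq_fun do rewrite mxE.
  rewrite mxE; apply: is_derive_mxE.
  by apply: derivableP; exact: smooth_derivable.
have dYG : is_derive x (X x) (fun y => Y y *m G) ('D_(X x) Y x *m G).
  have := is_derive_mulmx dY (is_derive_cst G x (X x)).
  by rewrite mulmx0 addr0.
have := is_derive_mxE 0 0 (is_derive_mulmx dYG dZ).
rewrite /tensor_eval => [[_ ->]] /=; rewrite /planar_conn.
set F := planar_form x (X x).
have addE (M N : 'M[R]_1) : M 0 0 + N 0 0 = (M + N) 0 0 by rewrite mxE.
rewrite addE; congr (fun_of_matrix _ 0 0).
rewrite [(_ + _)^T]linearD /= trmx_mul !mulmxDl !mulmxDr addrACA -[LHS]addr0.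
congr (_ + _); rewrite !mulmxA -(mulmxA _ F) -mulmxDl.
by rewrite -(mulmxA _ G) -mulmxDr skew mulmx0 mul0mx.
Qed.

(** * Polynomial loops and their holonomy *)

Lemma smooth_horner (p : {poly R}) : smooth (horner p).
Proof.
elim/poly_ind: p => [|p c sp].
  rewrite (_ : horner 0 = fun=> 0); first exact: smooth_cst.
  by apply/funext => u; rewrite horner0.
rewrite (_ : horner _ = fun u => p.[u] * u + c).
  by apply: smoothD; [apply: smoothM => //; exact: smooth_id|exact: smooth_cst].
by apply/funext => u; rewrite hornerMXaddC.
Qed.

Lemma is_derive_mx_comp m p (E : R -> 'M[R]_(m, p)) (dE : R -> 'M[R]_(m, p))
    (f : R -> R) (df u : R) :
  (forall s : R, is_derive s 1 E (dE s)) -> is_derive u 1 f df ->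
  is_derive u 1 (fun y => E (f y)) (df *: dE (f u)).
Proof.
move=> dEs dfu; apply: is_derive_mx => i j; rewrite mxE mulrC.
apply: (@is_derive1_comp _ (fun y => E y i j) f) => //.
exact: is_derive_mxE.
Qed.

(* The connection form restricted to a plane parallel to e_i0 and e_k takes its
   values in the line through A k, so parallel transport in such a plane is
   v |-> v *m E (- phi) with phi' = (c u)_i0 * beta'.  The loop below has
   beta = u - u^2 and encloses the area needed to get phi 1 = - t. *)
Lemma planar_holonomy (E : R -> 'M[R]_n) k t x :
  A i0 = 0 -> k != i0 -> E 0 = 1%:M ->
  (forall s : R, is_derive s 1 E (E s *m A k)) -> E t \in unitmx ->
  holonomy planar_connection x (E t).
Proof.
move=> A0 ki0 E0 dE Et; split=> //.
pose horE := (hornerD, hornerN, hornerX, hornerZ, hornerMn, hornerXn,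
  hornerC).
pose derE := (derivD, derivN, derivZ, derivXn, derivX).
(* Both polynomials vanish at 0 and 1, so the curve closes. Since beta' is odd about 1/2, alpha must
   not be even about it; the integral of (u^2 - u^3)(1 - 2u) over [0, 1] is -1/60, whence the factor
   60. *)
pose alpha : {poly R} := (60 * t) *: ('X^2 - 'X^3).
pose beta : {poly R} := 'X - 'X^2.
(* The primitive of (x_i0 + alpha) beta' that vanishes at 0. *)
pose phi : {poly R} :=
  x 0 i0 *: beta + t *: (20 *: 'X^3 - 45 *: 'X^4 + 24 *: 'X^5).
pose c u := x + alpha.[u] *: delta_mx 0 i0 + beta.[u] *: delta_mx 0 k.
have sc : smooth c.
  apply: smoothD; first apply: smoothD; first exact: smooth_cst.
    exact/smoothZl/smooth_horner.
  exact/smoothZl/smooth_horner.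
have c0 : c 0 = x.
  have [a0 b0] : alpha.[0] = 0 /\ beta.[0] = 0.
    by rewrite /alpha /beta !horE; split; ring.
  by rewrite /c a0 b0 !scale0r !addr0.
have c1 : c 1 = x.
  have [a1 b1] : alpha.[1] = 0 /\ beta.[1] = 0.
    by rewrite /alpha /beta !horE; split; ring.
  by rewrite /c a1 b1 !scale0r !addr0.
have phi0 : phi.[0] = 0 by rewrite /phi /beta !horE; ring.
have phi1 : phi.[1] = - t by rewrite /phi /beta !horE; ring.
have dc (u : R) : is_derive u 1 c
    (alpha^`().[u] *: delta_mx 0 i0 + beta^`().[u] *: delta_mx 0 k).
  have dZ (q : {poly R}) (w : 'rV[R]_n) :
      is_derive u 1 (fun y => q.[y] *: w) (q^`().[u] *: w).
    have := is_derive_scale (is_derive_poly q u) (is_derive_cst w u 1).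
    by rewrite scaler0 addr0.
  rewrite -[X in is_derive _ _ _ (X + _)]add0r.
  by do 2! apply: is_deriveD.
exists [:: 0; 1], c; split => //.
- by split=> //=; rewrite ltr01.
- by case=> [|[]] // _; exists c.
(* From E' = E A_k the chain rule gives V' = - phi' V A_k, which is the transport equation because
   the connection form on c' is phi' A_k. *)
move=> v; exists (fun u => v *m E (- phi.[u])).
have dV (u : R) : is_derive u 1 (fun u => v *m E (- phi.[u]))
   (- christoffel planar_connection (c u) ('D_1 c u) (v *m E (- phi.[u]))).
  rewrite planar_christoffel.
  have -> : planar_form (c u) ('D_1 c u) = phi^`().[u] *: A k.
    have [_ ->] := dc u.
    rewrite planar_formD !planar_formZ !planar_form_delta A0 !scaler0 add0r.
    rewrite scalerA !mxE !eqxx eq_sym (negbTE ki0) mulr0 addr0 mulr1.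
    congr (_ *: _).
    by rewrite /phi /alpha /beta !derE !horE /=; ring.
  have dphi : is_derive u 1 (fun y => - phi.[y]) (- phi^`().[u]).
    exact: is_deriveN.
  have := is_derive_mulmx (is_derive_cst v u 1) (is_derive_mx_comp dE dphi).
  by rewrite mul0mx add0r scaleNr mulmxN -scalemxAr mulmxA -!scalemxAr.
split.
- split; last by move=> i _ u _; exact: dV.
  apply: continuous_subspaceT => u; apply: differentiable_continuous.
  by apply/derivable1_diffP; case: (dV u).
- by rewrite phi0 oppr0 E0 mulmx1.
- by rewrite phi1 opprK.
Qed.

End PlanarConnection.

(** * Exponentials of matrices with A^3 = A or A^3 = - A *)

Section CubicFlow.
Context {R : realType}.

(* p and q are sin and 1 - cos, or sinh and cosh - 1. *)
Lemma cubic_flow_coefs (c : R) : c = 1 \/ c = -1 ->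
  exists (p q : R -> R) (t : R),
    [/\ p 0 = 0, q 0 = 0,
        forall s : R, is_derive s 1 p (1 + c * q s),
        forall s : R, is_derive s 1 q (p s) &
        [/\ p t != 0, p (- t) = - p t, q (- t) = q t &
            2 * q t = p t ^+ 2 - c * q t ^+ 2]].
Proof.
case=> ->; last first.
  (* At a quarter turn both [p] and [q] equal 1. *)
  exists sin, (fun s => 1 - cos s), (pi / 2); split.
  - exact: sin0.
  - by rewrite cos0 subrr.
  - by move=> s; apply: is_derive_eq; rewrite mulN1r opprB addrCA subrr addr0.
  - move=> s; have := is_deriveB (is_derive_cst (1 : R) s 1) (is_derive_cos s).
    by rewrite sub0r opprK.
  - rewrite sinN cosN sin_pihalf cos_pihalf; split=> //=; ring.
pose d s : R := expR (- s).
have dd (s : R) : is_derive s 1 d (- d s).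
  have := is_derive1_comp (is_derive_expR (- s)) (is_deriveNid s 1).
  by rewrite mulrN1.
exists (fun s => 2^-1 * (expR s - d s)), (fun s => 2^-1 * (expR s + d s) - 1), 1.
split.
- by rewrite /d oppr0 subrr mulr0.
- by rewrite /d oppr0 expR0; lra.
- move=> s; have de := is_deriveB (is_derive_expR s) (dd s).
  apply: is_derive_eq (is_deriveM (is_derive_cst (2^-1 : R) s 1) de) _.
  by rewrite scaler0 addr0 /GRing.scale /= /cst; lra.
- move=> s; have de := is_deriveD (is_derive_expR s) (dd s).
  have dh := is_deriveM (is_derive_cst (2^-1 : R) s 1) de.
  apply: is_derive_eq (is_deriveB dh (is_derive_cst (1 : R) s 1)) _.
  by rewrite scaler0 addr0 subr0 /GRing.scale /= /cst; lra.
(* [e1] is cosh^2 - sinh^2 = 1 at the point 1, which is the required quadratic relation; with [e2]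
   it excludes sinh 1 = 0. *)
- have e1 : expR 1 * d 1 = 1 :> R by rewrite /d expRxMexpNx_1.
  have e2 : 1 < expR 1 :> R by rewrite expR_gt1.
  split.
  + rewrite mulf_neq0 ?invr_eq0 ?pnatr_eq0 // subr_eq0; apply/eqP => e3.
    by move: e1; rewrite -e3; nra.
  + by rewrite /d opprK; lra.
  + by rewrite /d opprK; lra.
  + by move: e1; nra.
Qed.

Context {n : nat}.

(** When [p] and [q] vanish at 0, [E s] is exp(s A): the relation A^3 = c A confines the series to
    the span of 1, A and A^2, and the equations for [p] and [q] are the components of E' = E A. *)
Lemma cubic_flow (A : 'M[R]_n) (c : R) (p q : R -> R) :
  A *m A *m A = c *: A ->
  (forall s : R, is_derive s 1 p (1 + c * q s)) ->
  (forall s : R, is_derive s 1 q (p s)) ->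
  let E s := 1%:M + p s *: A + q s *: (A *m A) in
  forall s : R, is_derive s 1 E (E s *m A).
Proof.
move=> A3 dp dq E s.
have dpA := is_derive_scale (dp s) (is_derive_cst A s 1).
have dqA := is_derive_scale (dq s) (is_derive_cst (A *m A) s 1).
have d1 := is_derive_cst (1%:M : 'M[R]_n) s 1.
apply: is_derive_eq (is_deriveD (is_deriveD d1 dpA) dqA) _.
rewrite !scaler0 !addr0 add0r /E !mulmxDl mul1mx -!scalemxAl A3 scalerA.
by rewrite scalerDl scale1r [q s * c]mulrC addrAC.
Qed.

(** Replacing A by - A gives the inverse: the product is 1 + (2b - a^2 + c b^2) A^2. *)
Lemma cubic_flow_unit (A : 'M[R]_n) (a b c : R) :
  A *m A *m A = c *: A -> 2 * b = a ^+ 2 - c * b ^+ 2 ->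
  1%:M + a *: A + b *: (A *m A) \in unitmx.
Proof.
move=> A3 abc.
suff /mulmx1_unit[] : (1%:M + a *: A + b *: (A *m A)) *m
    (1%:M - a *: A + b *: (A *m A)) = 1%:M by [].
have A3' : A *m (A *m A) = c *: A by rewrite mulmxA.
have A4 : A *m A *m (A *m A) = c *: (A *m A) by rewrite mulmxA A3 scalemxAl.
rewrite !(mulmxDl, mulmxDr) !mulmxN !mul1mx !mulmx1 -!scalemxAl -!scalemxAr.
rewrite !scalerA A3 A3' A4 !scalerA.
apply/matrixP => i j; rewrite !mxE.
set u := A i j; set v := \sum_k _.
have := congr1 ( *%R^~ v) abc; lra.
Qed.

(** The odd part of the flow is [p s *: A k], so the two holonomies [E t] and [E (- t)] differ by a
    nonzero multiple of [A k]. This passes from the group to its generators without a limit. *)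
Lemma planar_holonomy_invariant i0 (A : 'I_n -> 'M[R]_n) k c x
    (W : {vspace 'rV[R]_n}) :
  A i0 = 0 -> c = 1 \/ c = -1 -> A k *m A k *m A k = c *: A k ->
  (forall B, holonomy (planar_connection i0 A) x B ->
     forall v, v \in W -> v *m B \in W) ->
  forall v, v \in W -> v *m A k \in W.
Proof.
move=> A0 c1 A3 HW v vW.
have [->|ki0] := eqVneq k i0; first by rewrite A0 mulmx0 mem0v.
have [p [q [t [p0 q0 dp dq [pt pN qN pq]]]]] := cubic_flow_coefs c1.
pose E s := 1%:M + p s *: A k + q s *: (A k *m A k).
have E0 : E 0 = 1%:M by rewrite /E p0 q0 !scale0r !addr0.
have dE := cubic_flow A3 dp dq.
have Et : v *m E t \in W.
  apply: HW => //; apply: planar_holonomy ki0 E0 dE _ => //.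
  exact: cubic_flow_unit pq.
have EN : v *m E (- t) \in W.
  apply: HW => //; apply: planar_holonomy ki0 E0 dE _ => //.
  by apply: cubic_flow_unit A3 _; rewrite pN qN sqrrN.
have EB : E t - E (- t) = (2 * p t) *: A k.
  by rewrite /E pN qN; apply/matrixP => i j; rewrite !mxE; ring.
have -> : v *m A k = (2 * p t)^-1 *: (v *m E t - v *m E (- t)).
  rewrite -mulmxBr EB -scalemxAr scalerA mulVf ?scale1r //.
  by rewrite mulf_neq0 ?pnatr_eq0.
by rewrite memvZ // memvB.
Qed.

End CubicFlow.

(** * Irreducibility *)

Section Stabilizer.
Context {F : fieldType} {n : nat}.
Variable W : {vspace 'rV[F]_n}.

Definition stab (A : 'M[F]_n) := forall v, v \in W -> v *m A \in W.

Lemma stabM A B : stab A -> stab B -> stab (A *m B).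
Proof. by move=> sA sB v vW; rewrite mulmxA; apply/sB/sA. Qed.

Lemma stabD A B : stab A -> stab B -> stab (A + B).
Proof. by move=> sA sB v vW; rewrite mulmxDr memvD ?sA ?sB. Qed.

Lemma stabZ a A : stab A -> stab (a *: A).
Proof. by move=> sA v vW; rewrite -scalemxAr memvZ ?sA. Qed.

Lemma stabN A : stab A -> stab (- A).
Proof. by move=> sA; rewrite -scaleN1r; exact: stabZ. Qed.

(** A nonzero [W] contains the nonzero vector [vpick W], which stabilizing matrices carry, inside
    [W], to every basis vector. *)
Lemma stab_transitive :
  (forall (w : 'rV_n) j, w != 0 -> exists2 A, stab A & w *m A = delta_mx 0 j) ->
  W = 0%VS \/ W = fullv.
Proof.
move=> trW; have [->|W0] := eqVneq W 0%VS; [by left|right].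
apply/eqP; rewrite eqEsubv subvf /=; apply/subvP => v _.
rewrite [v]row_sum_delta memv_suml // => j _; rewrite memvZ //.
have [|A sA <-] := trW (vpick W) j; first by rewrite vpick0.
exact/sA/memv_pick.
Qed.

Section Units.
Context {m : nat} (a0 : 'I_m).

(** The infinitesimal rotation in the plane of [a0] and [a]. Joining all indices to one hub takes
    one matrix per coordinate direction, and the hub itself supplies the zero matrix required in
    direction [i0]. *)
Definition star (a : 'I_m) : 'M[F]_m := delta_mx a0 a - delta_mx a a0.

Lemma star0 : star a0 = 0. Proof. exact: subrr. Qed.

Lemma star_tr a : (star a)^T = - star a.
Proof. by rewrite linearB /= !trmx_delta opprB. Qed.

Lemma star_sqr a : a != a0 ->
  star a *m star a = - (delta_mx a0 a0 + delta_mx a a).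
Proof.
move=> aa0; rewrite /star !(mulmxBl, mulmxBr) !mul_delta_mx_cond !eqxx.
by rewrite (negbTE aa0) eq_sym (negbTE aa0) !mulr0n !mulr1n sub0r subr0 opprD.
Qed.

(** For [a != a0] the matrix is a quarter turn of one coordinate plane and zero on the other basis
    vectors. *)
Lemma star_cube a : star a *m star a *m star a = - star a.
Proof.
have [->|aa0] := eqVneq a a0; first by rewrite star0 mulmx0 oppr0.
rewrite star_sqr // mulNmx /star !(mulmxDl, mulmxBr) !mul_delta_mx_cond !eqxx.
rewrite (negbTE aa0) eq_sym (negbTE aa0) !mulr0n !mulr1n.
by rewrite sub0r subr0.
Qed.

Variables iota phi : 'M[F]_m -> 'M[F]_n.
Hypothesis iotaM : forall A B, iota (A *m B) = iota A *m iota B.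
Hypothesis iotaN : forall A, iota (- A) = - iota A.

(** Multiplication by E_00 on either side cuts the two-term star matrices down to the units E_a0 and
    E_0b, whose products are all matrix units. *)
Lemma stab_units : stab (iota (delta_mx a0 a0)) ->
  (forall a, stab (iota (star a))) -> forall a b, stab (iota (delta_mx a b)).
Proof.
move=> s0 sR a b.
have -> : delta_mx a b = delta_mx a a0 *m delta_mx a0 b :> 'M[F]_m.
  by rewrite mul_delta_mx.
rewrite iotaM; apply: stabM.
  have [->//|aa0] := eqVneq a a0.
  have -> : delta_mx a a0 = - (star a *m delta_mx a0 a0).
    rewrite /star mulmxBl !mul_delta_mx_cond eqxx (negbTE aa0) mulr0n mulr1n.
    by rewrite sub0r opprK.
  by rewrite iotaN iotaM; exact/stabN/stabM.
have [->//|ba0] := eqVneq b a0.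
have -> : delta_mx a0 b = delta_mx a0 a0 *m star b.
  rewrite /star mulmxBr !mul_delta_mx_cond eqxx eq_sym (negbTE ba0) mulr0n.
  by rewrite subr0.
by rewrite iotaM; exact: stabM.
Qed.

Hypothesis phiMr : forall A B, phi (A *m B) = phi A *m iota B.
Hypothesis phiMl : forall A B, phi (A *m B) = iota A *m phi B.

(** Here [phi] stands for an imaginary unit times [iota]. Matrix units on both sides of one star
    matrix isolate a single entry and move it anywhere. *)
Lemma stab_units_bimod c : (forall a b, stab (iota (delta_mx a b))) ->
  c != a0 -> stab (phi (star c)) -> forall a b, stab (phi (delta_mx a b)).
Proof.
move=> sE ca0 sR a b.
have -> : delta_mx a b = delta_mx a a0 *m (star c *m delta_mx c b) :> 'M[F]_m.
  rewrite /star mulmxBl !mul_delta_mx_cond eqxx eq_sym (negbTE ca0) mulr0n.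
  by rewrite subr0 mul_delta_mx.
by rewrite phiMl phiMr; apply: stabM => //; exact: stabM.
Qed.

End Units.
End Stabilizer.

(** * Complex matrices in real block form *)

Section ComplexMatrices.
Context {F : realFieldType} {m : nat}.
Implicit Types B C : 'M[F]_m.

(* Right multiplication by the complex matrix B + i C on C^m = R^m + i R^m. *)
Definition cmx B C : 'M[F]_(m + m) := block_mx B C (- C) B.

Lemma cmxM B C B' C' :
  cmx B C *m cmx B' C' = cmx (B *m B' - C *m C') (B *m C' + C *m B').
Proof.
rewrite /cmx mulmx_block !mulNmx !mulmxN opprD; congr block_mx.
  by rewrite addrC.
by rewrite addrC.
Qed.

Lemma cmxN B C : - cmx B C = cmx (- B) (- C).
Proof. by rewrite /cmx opp_block_mx. Qed.

Lemma mul_row_cmx p (u v : 'M[F]_(p, m)) B C :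
  row_mx u v *m cmx B C = row_mx (u *m B - v *m C) (u *m C + v *m B).
Proof. by rewrite /cmx mul_row_block mulmxN. Qed.

Lemma cmx_cube_re B : B *m B *m B = - B ->
  cmx B 0 *m cmx B 0 *m cmx B 0 = (-1) *: cmx B 0.
Proof.
move=> B3; rewrite !(cmxM, mulmx0, mul0mx, subr0, addr0) B3 scaleN1r.
by rewrite cmxN oppr0.
Qed.

(** As i^3 = - i, the sign changes: real star matrices generate rotations, imaginary ones hyperbolic
    flows. *)
Lemma cmx_cube_im C : C *m C *m C = - C ->
  cmx 0 C *m cmx 0 C *m cmx 0 C = 1 *: cmx 0 C.
Proof.
move=> C3; rewrite !(cmxM, mulmx0, mul0mx, sub0r, addr0, oppr0) mulNmx C3.
by rewrite opprK scale1r.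
Qed.

Lemma row_mul_delta n p (u : 'rV[F]_n) (b : 'I_n) (c : 'I_p) :
  u *m delta_mx b c = u 0 b *: delta_mx 0 c.
Proof.
apply/rowP => j; rewrite !mxE (bigD1 b) //= big1 ?addr0 => [|i ib].
  by rewrite !mxE !eqxx.
by rewrite mxE (negbTE ib) mulr0.
Qed.

Lemma delta_row_mxl n1 n2 (c : 'I_n1) :
  delta_mx 0 (lshift n2 c) = row_mx (delta_mx 0 c) 0 :> 'rV[F]_(n1 + n2).
Proof.
apply/rowP => j; rewrite !mxE.
by case: split_ordP => k ->; rewrite !mxE ?eq_lshift ?eq_rlshift ?andbF.
Qed.

Lemma delta_row_mxr n1 n2 (c : 'I_n2) :
  delta_mx 0 (rshift n1 c) = row_mx 0 (delta_mx 0 c) :> 'rV[F]_(n1 + n2).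
Proof.
apply/rowP => j; rewrite !mxE.
by case: split_ordP => k ->; rewrite !mxE ?eq_rshift ?eq_lrshift ?andbF.
Qed.

Lemma complex_irreducible (W : {vspace 'rV[F]_(m + m)}) (a0 a1 a2 : 'I_m) :
  a1 != a0 -> a2 != a0 -> a1 != a2 ->
  (forall a, stab W (cmx (star a0 a) 0)) ->
  (forall a, stab W (cmx 0 (star a0 a))) ->
  W = 0%VS \/ W = fullv.
Proof.
move=> a10 a20 a12 sre sim.
pose iota B := cmx B 0; pose phi C := cmx 0 C.
have iotaM B B' : iota (B *m B') = iota B *m iota B'.
  by rewrite /iota cmxM !mulmx0 mul0mx subr0 addr0.
have iotaN B : iota (- B) = - iota B by rewrite /iota cmxN oppr0.
have phiMr C B : phi (C *m B) = phi C *m iota B.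
  by rewrite /iota /phi cmxM !mulmx0 !mul0mx subr0 add0r.
have phiMl B C : phi (B *m C) = iota B *m phi C.
  by rewrite /iota /phi cmxM !mulmx0 !mul0mx subr0 addr0.
have sE : forall a b, stab W (iota (delta_mx a b)).
  apply: (stab_units iotaM iotaN _ sre).
  (* The squares are -(E_00 + E_11) and -(E_00 + E_22); with three distinct indices only E_00
     survives in their product. *)
  have -> : delta_mx a0 a0 =
      star a0 a1 *m star a0 a1 *m (star a0 a2 *m star a0 a2) :> 'M[F]_m.
    rewrite !star_sqr // mulNmx mulmxN opprK !(mulmxDl, mulmxDr).
    rewrite !mul_delta_mx_cond !eqxx (negbTE a10) (negbTE a12) eq_sym (negbTE a20).
    by rewrite !mulr0n !mulr1n !addr0.
  by rewrite !iotaM; do !apply: stabM; exact: sre.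
have sF : forall a b, stab W (phi (delta_mx a b)).
  exact: (stab_units_bimod phiMr phiMl sE a10 (sim a1)).
apply: stab_transitive => w j w0.
rewrite -[w]hsubmxK in w0 *.
move: (lsubmx w) (rsubmx w) w0 => u v w0.
have [b ub] : exists b, u 0 b ^+ 2 + v 0 b ^+ 2 != 0.
  apply/existsP; apply: contraNT w0 => /existsPn uv0.
  suff [-> ->] : u = 0 /\ v = 0 by rewrite row_mx0.
  by split; apply/rowP => b; rewrite mxE; have := uv0 b; rewrite negbK; nra.
have E c : exists2 A, stab W A & row_mx u v *m A = row_mx (delta_mx 0 c) 0.
  (* This is z^-1 E_bc for the nonzero complex coordinate z = u_b + i v_b, the inverse being written
     as conjugate over squared norm. *)
  exists ((u 0 b ^+ 2 + v 0 b ^+ 2)^-1 *: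
    (u 0 b *: iota (delta_mx b c) - v 0 b *: phi (delta_mx b c))).
    by apply/stabZ/stabD; [exact: stabZ|exact/stabN/stabZ].
  rewrite -scalemxAr mulmxBr -!scalemxAr !mul_row_cmx !row_mul_delta !mulmx0.
  rewrite subr0 sub0r add0r addr0 !scale_row_mx opp_row_mx add_row_mx.
  rewrite scale_row_mx; congr row_mx; apply/rowP => k; rewrite !mxE; field.
    exact: ub.
  exact: ub.
case: (split_ordP j) => c ->.
  by rewrite delta_row_mxl; exact: E.
have [A sA uvA] := E c.
(* Multiplication by i E_cc reaches the imaginary basis vector. *)
exists (A *m phi (delta_mx c c)); first exact: stabM.
rewrite mulmxA uvA mul_row_cmx delta_row_mxr !mulmx0 !mul0mx row_mul_delta.
by rewrite mxE !eqxx scale1r subr0 addr0.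
Qed.

End ComplexMatrices.

(** * Quaternionic matrices in real block form *)

Section QuaternionicMatrices.
Context {F : realFieldType} {r : nat}.

(* With eps = [0 1; -1 0], sigma = [1 0; 0 -1] and tau = [0 1; 1 0], the matrices
   1 (x) eps, eps (x) sigma and eps (x) tau satisfy the relations of the
   quaternion units on R^2 (x) R^2 = H; qmx M0 M1 M2 M3 is the quaternionic
   matrix with components M0, M1, M2, M3 with respect to 1 and these units. *)
Definition qmx (M0 M1 M2 M3 : 'M[F]_r) : 'M[F]_((r + r) + (r + r)) :=
  cmx (block_mx M0 M1 (- M1) M0) (block_mx M2 M3 M3 (- M2)).

Lemma mul_row_qmx p (u0 u1 u2 u3 : 'M[F]_(p, r)) M0 M1 M2 M3 :
  row_mx (row_mx u0 u1) (row_mx u2 u3) *m qmx M0 M1 M2 M3 =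
  row_mx (row_mx (u0 *m M0 - u1 *m M1 - u2 *m M2 - u3 *m M3)
                 (u0 *m M1 + u1 *m M0 - u2 *m M3 + u3 *m M2))
         (row_mx (u0 *m M2 + u1 *m M3 + u2 *m M0 - u3 *m M1)
                 (u0 *m M3 - u1 *m M2 + u2 *m M1 + u3 *m M0)).
Proof.
rewrite /qmx mul_row_cmx !mul_row_block !(opp_row_mx, add_row_mx) !mulmxN.
congr row_mx; congr row_mx.
- by rewrite opprD addrA.
- by rewrite opprD opprK addrA.
- by rewrite addrA.
- by rewrite addrA.
Qed.

Lemma qmx_mulr M0 M1 M2 M3 B :
  qmx M0 M1 M2 M3 *m qmx B 0 0 0 = qmx (M0 *m B) (M1 *m B) (M2 *m B) (M3 *m B).
Proof.
rewrite /qmx oppr0 cmxM !mulmx_block.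
by rewrite !(mulmx0, mul0mx, addr0, add0r, subr0, mulNmx, block_mx0, oppr0).
Qed.

Lemma qmx_mull M0 M1 M2 M3 B :
  qmx B 0 0 0 *m qmx M0 M1 M2 M3 = qmx (B *m M0) (B *m M1) (B *m M2) (B *m M3).
Proof.
rewrite /qmx oppr0 cmxM !mulmx_block.
by rewrite !(mulmx0, mul0mx, addr0, add0r, subr0, mulmxN, block_mx0, oppr0).
Qed.

Lemma quaternionic_irreducible (W : {vspace 'rV[F]_((r + r) + (r + r))})
    (a0 a1 : 'I_r) :
  a1 != a0 ->
  (forall a, stab W (qmx (star a0 a) 0 0 0)) ->
  stab W (qmx 0 (delta_mx a0 a0) 0 0) ->
  (forall a, stab W (qmx 0 0 (star a0 a) 0)) ->
  (forall a, stab W (qmx 0 0 0 (star a0 a))) ->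
  W = 0%VS \/ W = fullv.
Proof.
move=> a10 s0 s1 s2 s3.
pose iota B := qmx B 0 0 0.
have iotaM B B' : iota (B *m B') = iota B *m iota B'.
  by rewrite /iota qmx_mulr !mul0mx.
have iotaN B : iota (- B) = - iota B.
  by rewrite /iota /qmx cmxN !opp_block_mx !oppr0.
have sE : forall a b, stab W (iota (delta_mx a b)).
  apply: (stab_units iotaM iotaN _ s0).
  (* An imaginary unit squares to -1, so here E_00 comes from a single generator, and two indices
     suffice. *)
  have -> : iota (delta_mx a0 a0) =
      - (qmx 0 (delta_mx a0 a0) 0 0 *m qmx 0 (delta_mx a0 a0) 0 0).
    rewrite /iota /qmx cmxM !mulmx_block cmxN.
    rewrite !(mulmx0, mul0mx, addr0, add0r, subr0, mulmxN, mulNmx, oppr0).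
    by rewrite !(block_mx0, mulmx0, mul0mx, addr0, subr0, oppr0) opp_block_mx
      mul_delta_mx opprK oppr0.
  exact/stabN/stabM.
have sE1 a b : stab W (qmx 0 (delta_mx a b) 0 0).
  have -> : qmx 0 (delta_mx a b) 0 0 =
      iota (delta_mx a a0) *m qmx 0 (delta_mx a0 a0) 0 0 *m iota (delta_mx a0 b).
    by rewrite qmx_mull qmx_mulr !mulmx0 !mul0mx !mul_delta_mx.
  by apply: stabM => //; exact: stabM.
have sE2 a b : stab W (qmx 0 0 (delta_mx a b) 0).
  move: a b; apply: (@stab_units_bimod _ _ W _ a0 iota (fun B => qmx 0 0 B 0)
    _ _ a1) => // B B'; first by rewrite qmx_mulr !mul0mx.
  by rewrite qmx_mull !mulmx0.
have sE3 a b : stab W (qmx 0 0 0 (delta_mx a b)).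
  move: a b; apply: (@stab_units_bimod _ _ W _ a0 iota (fun B => qmx 0 0 0 B)
    _ _ a1) => // B B'; first by rewrite qmx_mulr !mul0mx.
  by rewrite qmx_mull !mulmx0.
apply: stab_transitive => w j w0.
rewrite -[w]hsubmxK -[lsubmx w]hsubmxK -[rsubmx w]hsubmxK in w0 *.
move: (lsubmx (lsubmx w)) (rsubmx (lsubmx w)) (lsubmx (rsubmx w))
  (rsubmx (rsubmx w)) w0 => u0 u1 u2 u3 {w} w0.
pose d b := u0 0 b ^+ 2 + u1 0 b ^+ 2 + u2 0 b ^+ 2 + u3 0 b ^+ 2.
have [b db] : exists b, d b != 0.
  apply/existsP; apply: contraNT w0 => /existsPn d0.
  have u b : [/\ u0 0 b = 0, u1 0 b = 0, u2 0 b = 0 & u3 0 b = 0].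
    by have := d0 b; rewrite negbK /d => /eqP db; split; nra.
  suff [-> -> -> ->] : [/\ u0 = 0, u1 = 0, u2 = 0 & u3 = 0] by rewrite !row_mx0.
  by split; apply/rowP => b; rewrite mxE; case: (u b).
have E c : exists2 A, stab W A & row_mx (row_mx u0 u1) (row_mx u2 u3) *m A =
    row_mx (row_mx (delta_mx 0 c) 0) 0.
  (* E_bc times the inverse of the b-th quaternion coordinate: its conjugate over the squared norm
     [d b]. *)
  exists ((d b)^-1 *: (u0 0 b *: qmx (delta_mx b c) 0 0 0
    - u1 0 b *: qmx 0 (delta_mx b c) 0 0
    - u2 0 b *: qmx 0 0 (delta_mx b c) 0
    - u3 0 b *: qmx 0 0 0 (delta_mx b c))).
    apply/stabZ/stabD; last exact/stabN/stabZ.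
    apply/stabD; last exact/stabN/stabZ.
    by apply/stabD; [apply: stabZ; exact: sE|exact/stabN/stabZ].
  rewrite -scalemxAr !mulmxBr -!scalemxAr !mul_row_qmx !row_mul_delta.
  rewrite !(mulmx0, addr0, add0r, subr0, sub0r).
  rewrite !(scale_row_mx, opp_row_mx, add_row_mx) -row_mx0.
  by congr (row_mx (row_mx _ _) (row_mx _ _)); apply/rowP => k; rewrite !mxE;
    rewrite /d in db *; field.
(* Following [E c] by an imaginary unit times E_cc moves the real basis vector to the other three
   components. *)
have E0 c (A : 'M[F]_((r + r) + (r + r))) : stab W A ->
    exists2 B, stab W B & row_mx (row_mx u0 u1) (row_mx u2 u3) *m B =
      row_mx (row_mx (delta_mx 0 c) 0) 0 *m A.
  move=> sA; have [B sB <-] := E c.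
  by exists (B *m A); [exact: stabM|rewrite mulmxA].
case: (split_ordP j) => j' ->; case: (split_ordP j') => c ->.
- by rewrite !delta_row_mxl; exact: E.
- have [B sB uB] := E0 c _ (sE1 c c); exists B => //.
  rewrite uB -[X in row_mx _ X](row_mx0) mul_row_qmx delta_row_mxl delta_row_mxr.
  by rewrite !(mulmx0, mul0mx, addr0, add0r, subr0, mul_delta_mx) row_mx0.
- have [B sB uB] := E0 c _ (sE2 c c); exists B => //.
  rewrite uB -[X in row_mx _ X](row_mx0) mul_row_qmx delta_row_mxr delta_row_mxl.
  by rewrite !(mulmx0, mul0mx, addr0, add0r, subr0, mul_delta_mx) row_mx0.
- have [B sB uB] := E0 c _ (sE3 c c); exists B => //.
  rewrite uB -[X in row_mx _ X](row_mx0) mul_row_qmx !delta_row_mxr.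
  by rewrite !(mulmx0, mul0mx, addr0, add0r, subr0, mul_delta_mx) row_mx0.
Qed.

End QuaternionicMatrices.

(** * Parallel metrics *)

Section ConstantMetrics.
Context {R : realType} {m : nat}.
Implicit Types (Om : 'M[R]_m) (G P : 'M[R]_(m + m)).

(** One frame [P] serves at all points, and invertibility of [G] is read off from that of its
    diagonal form. *)
Lemma constant_metric G P :
  G^T = G -> P *m G *m P^T = block_mx 1%:M 0 0 (- 1%:M) ->
  semi_riemannian (fun _ : 'rV[R]_(m + m) => G) /\
  has_signature (fun _ : 'rV[R]_(m + m) => G) m m.
Proof.
move=> GT PGP.
have : P *m G *m P^T \in unitmx.
  rewrite PGP.
  suff /mulmx1_unit[] : block_mx 1%:M 0 0 (- 1%:M) *m
    block_mx 1%:M 0 0 (- 1%:M) = 1%:M :> 'M[R]_(m + m) by [].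
  rewrite mulmx_block !(mulmx0, mul0mx, mulmx1, addr0, add0r).
  by rewrite mulNmx mul1mx opprK -scalar_mx_block.
rewrite !unitmx_mul => /andP[/andP[uP uG] _].
split; first by split => [||x] //; exact: smooth_cst.
split=> // x; exists P => //; rewrite PGP; apply/matrixP => i j.
case: (split_ordP i) => a ->; case: (split_ordP j) => b ->;
  rewrite ?(block_mxEul, block_mxEur, block_mxEdl, block_mxEdr) !mxE.
- by rewrite eq_lshift /= ltn_ord.
- by rewrite eq_lrshift.
- by rewrite eq_rlshift.
- by rewrite eq_rshift /= ltnNge leq_addr /= mulNrn.
Qed.

(** The real part of the complex bilinear form with matrix 1, already diagonal. *)
Lemma re_metric :
  semi_riemannian (fun _ : 'rV[R]_(m + m) => block_mx 1%:M 0 0 (- 1%:M)) /\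
  has_signature (fun _ : 'rV[R]_(m + m) => block_mx 1%:M 0 0 (- 1%:M)) m m.
Proof.
apply: (@constant_metric _ 1%:M); last by rewrite mul1mx trmx1 mulmx1.
by rewrite tr_block_mx !trmx0 linearN /= trmx1.
Qed.

(** For [Om = 1] this is the imaginary part of the same form. The two halves are isotropic and
    paired by [Om], so the vectors with components e_i and plus or minus e_i Om / 2 have squares 1
    and -1. *)
Lemma im_metric Om : Om *m Om^T = 1%:M ->
  semi_riemannian (fun _ : 'rV[R]_(m + m) => block_mx 0 Om Om^T 0) /\
  has_signature (fun _ : 'rV[R]_(m + m) => block_mx 0 Om Om^T 0) m m.
Proof.
move=> OmT; pose H := 2^-1 *: Om.
apply: (@constant_metric _ (block_mx 1%:M H 1%:M (- H))).
  by rewrite tr_block_mx !trmx0 trmxK.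
have HT : H *m Om^T = 2^-1%:M by rewrite -scalemxAl OmT scalemx1.
have TH : Om *m H^T = 2^-1%:M by rewrite linearZ /= -scalemxAr OmT scalemx1.
rewrite tr_block_mx !mulmx_block linearN /= !trmx1.
rewrite !(mulmx0, mul1mx, mulmx1, addr0, add0r, mulNmx, mulmxN) HT TH.
congr block_mx.
- by rewrite -raddfD /=; congr (_%:M); lra.
- exact: subrr.
- by rewrite addrC subrr.
- by rewrite -opprD -raddfD /=; congr (- _%:M); lra.
Qed.

Definition cmx_family (Bl Br : 'I_m -> 'M[R]_m) (k : 'I_(m + m)) :=
  match fintype.split k with inl a => cmx (Bl a) 0 | inr a => cmx 0 (Br a) end.

Variables (Bl Br : 'I_m -> 'M[R]_m) (i0 : 'I_(m + m)).
Hypothesis BlT : forall a, (Bl a)^T = - Bl a.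
Hypothesis BrT : forall a, (Br a)^T = - Br a.

(** Skew-symmetric components put the complex matrices in so(m, C), which preserves the real part of
    the form. *)
Lemma re_metric_parallel :
  parallel_tensor (planar_connection i0 (cmx_family Bl Br))
    (fun=> block_mx 1%:M 0 0 (- 1%:M)).
Proof.
apply: planar_parallel => k; rewrite /cmx_family.
case: fintype.split => a; rewrite /cmx tr_block_mx linearN /= trmx0 ?BlT ?BrT.
  rewrite !mulmx_block !(mulmx0, mul0mx, mulmxN, mulNmx, mulmx1, mul1mx, oppr0).
  by rewrite !(addr0, add0r) add_block_mx !(opprK, subrr, addNr, addr0) block_mx0.
rewrite !mulmx_block !(mulmx0, mul0mx, mulmxN, mulNmx, mulmx1, mul1mx, opprK).
by rewrite !(addr0, add0r) add_block_mx !(subrr, addNr, addr0) block_mx0.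
Qed.

(** Skewness written in blocks. It is trivial for [Om = 1]; for skew [Om] it asks that [Bl] commute
    and [Br] anticommute with [Om]. *)
Lemma im_metric_parallel Om :
  (forall a, Bl a *m Om = Om *m Bl a) ->
  (forall a, Br a *m Om = Om^T *m Br a) ->
  (forall a, Br a *m Om^T = Om *m Br a) ->
  parallel_tensor (planar_connection i0 (cmx_family Bl Br))
    (fun=> block_mx 0 Om Om^T 0).
Proof.
move=> BlO BrO BrO'; apply: planar_parallel => k; rewrite /cmx_family.
have BlO' a : Bl a *m Om^T = Om^T *m Bl a.
  by apply: trmx_inj; rewrite !trmx_mul trmxK BlT mulmxN mulNmx BlO.
case: fintype.split => a; rewrite /cmx tr_block_mx linearN /= trmx0 ?BlT ?BrT.
  rewrite !mulmx_block !(mulmx0, mul0mx, addr0, add0r, oppr0, mulmxN).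
  by rewrite add_block_mx BlO BlO' !subrr addr0 block_mx0.
rewrite !mulmx_block !(mulmx0, mul0mx, addr0, add0r, opprK, mulmxN, mulNmx).
by rewrite add_block_mx BrO BrO' subrr addNr addr0 block_mx0.
Qed.

(** Invariance passes from the holonomy to its generators, with c = -1 for the real and c = 1 for
    the imaginary matrices; the direction [i0] lies in the real half, where [Bl a0 = 0]. *)
Lemma cmx_family_irreducible (a0 : 'I_m) :
  i0 = lshift m a0 -> Bl a0 = 0 ->
  (forall a, Bl a *m Bl a *m Bl a = - Bl a) ->
  (forall a, Br a *m Br a *m Br a = - Br a) ->
  (forall W : {vspace 'rV[R]_(m + m)}, (forall a, stab W (cmx (Bl a) 0)) ->
     (forall a, stab W (cmx 0 (Br a))) -> W = 0%VS \/ W = fullv) ->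
  irreducible_holonomy (planar_connection i0 (cmx_family Bl Br)).
Proof.
move=> -> Bl0 Bl3 Br3 irr x W HW.
have A0 : cmx_family Bl Br (lshift m a0) = 0.
  by rewrite /cmx_family (unsplitK (inl a0)) Bl0 /cmx oppr0 block_mx0.
apply: irr => a v vW.
  have := @planar_holonomy_invariant R _ _ _ (lshift m a) (-1) x W A0.
  rewrite /cmx_family (unsplitK (inl a)); apply => //; first by right.
  exact: cmx_cube_re.
have := @planar_holonomy_invariant R _ _ _ (rshift m a) 1 x W A0.
rewrite /cmx_family (unsplitK (inr a)); apply => //; first by left.
exact: cmx_cube_im.
Qed.

End ConstantMetrics.

(** * Choice of generators and metrics in the complex and quaternionic cases *)

Theorem theorem2 (R : realType) :
  (forall n m : nat, n = (2 * m)%N -> (3 <= m)%N ->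
    exists (nabla : linear_connection R n)
           (g : 'I_2 -> 'rV[R]_n -> 'M[R]_n),
      irreducible_holonomy nabla /\
      independent g /\
      (forall i : 'I_2, semi_riemannian (g i) /\ has_signature (g i) m m /\
                        parallel_tensor nabla (g i))) /\
  (forall n m r : nat, n = (2 * m)%N -> m = (2 * r)%N -> (2 <= r)%N ->
    exists (nabla : linear_connection R n)
           (g : 'I_3 -> 'rV[R]_n -> 'M[R]_n),
      irreducible_holonomy nabla /\
      independent g /\
      (forall i : 'I_3, semi_riemannian (g i) /\ has_signature (g i) m m /\
                        parallel_tensor nabla (g i))).
Proof.
split=> [n m|n m r].
  rewrite mul2n -addnn => -> m3.
  pose a0 : 'I_m := Ordinal (ltnW (ltnW m3)).
  pose a1 : 'I_m := Ordinal (ltnW m3).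
  pose a2 : 'I_m := Ordinal m3.
  pose B := @star R m a0.
  exists (planar_connection (lshift m a0) (cmx_family B B)).
  exists (fun i _ => nth 0 [:: block_mx 1%:M 0 0 (- 1%:M);
                               block_mx 0 1%:M 1%:M^T 0] i).
  split; [|split].
  - apply: (cmx_family_irreducible (a0 := a0)) => //; first exact: star0.
    + exact: star_cube.
    + exact: star_cube.
    + by move=> W; exact: (@complex_irreducible R m W a0 a1 a2).
  (* The two constant metrics occupy different blocks, so one entry of each block isolates one
     coefficient. *)
  - move=> a /(_ 0); rewrite !big_ord_recl big_ord0 /= addr0 trmx1.
    rewrite !scale_block_mx add_block_mx !scaler0 !(addr0, add0r) -block_mx0.
    move=> /eq_block_mx[/matrixP/(_ a0 a0) e0 /matrixP/(_ a0 a0) e1 _ _].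
    move: e0 e1; rewrite !mxE eqxx !mulr1 => e0 e1.
    by case=> [[|[|//]]] lti; [rewrite -e0|rewrite -e1]; congr a; exact: val_inj.
  - have BT a : (B a)^T = - B a by exact: star_tr.
    case=> [[|[|//]]] lti /=.
      have [? ?] := @re_metric R m; do !split=> //; exact: re_metric_parallel.
    have [|? ?] := @im_metric R m 1%:M; first by rewrite trmx1 mulmx1.
    do !split=> //; apply: im_metric_parallel => // a;
      by rewrite ?trmx1 ?mulmx1 ?mul1mx.
rewrite !mul2n -!addnn => -> -> r2.
pose a0 : 'I_r := Ordinal (ltnW r2).
pose a1 : 'I_r := Ordinal r2.
pose S := @star R r a0.
(* In quaternionic components: star matrices times 1 and E_aa times the first unit in [Bl], star
   matrices times the second and third units in [Br]. Each is a skew factor tensor a symmetric one,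
   hence skew. *)
pose Bl k := match fintype.split k with
  | inl a => block_mx (S a) 0 0 (S a)
  | inr a => block_mx 0 (delta_mx a a) (- delta_mx a a) 0 end.
pose Br k := match fintype.split k with
  | inl a => block_mx (S a) 0 0 (- S a)
  | inr a => block_mx 0 (S a) (S a) 0 end.
(* This is eps tensor the identity: it commutes with 1 and eps, so with [Bl], and anticommutes with
   sigma and tau, so with [Br]. It yields the third invariant form. *)
pose Om : 'M[R]_(r + r) := block_mx 0 1%:M (- 1%:M) 0.
have OmT : Om^T = - Om.
  by rewrite tr_block_mx opp_block_mx !trmx0 linearN /= trmx1 oppr0 opprK.
have OmOm : Om *m Om^T = 1%:M.
  rewrite OmT mulmxN mulmx_block !(mulmx0, mul0mx, addr0, add0r).
  by rewrite mulmxN mulNmx mulmx1 opp_block_mx opprK oppr0 -scalar_mx_block.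
have ST a : (S a)^T = - S a by exact: star_tr.
have BlT k : (Bl k)^T = - Bl k.
  rewrite /Bl; case: fintype.split => a;
    rewrite tr_block_mx opp_block_mx !trmx0 oppr0.
    by rewrite ST.
  by rewrite linearN /= trmx_delta opprK.
have BrT k : (Br k)^T = - Br k.
  rewrite /Br; case: fintype.split => a;
    rewrite tr_block_mx opp_block_mx !trmx0 oppr0.
    by rewrite linearN /= ST.
  by rewrite ST.
exists (planar_connection (lshift (r + r) (lshift r a0)) (cmx_family Bl Br)).
exists (fun i _ => nth 0 [:: block_mx 1%:M 0 0 (- 1%:M);
                             block_mx 0 1%:M 1%:M^T 0;
                             block_mx 0 Om Om^T 0] i).
split; [|split].
- apply: (cmx_family_irreducible (a0 := lshift r a0)) => //.
  + by rewrite /Bl (unsplitK (inl a0)) /S star0 block_mx0.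
  + move=> k; rewrite /Bl; case: fintype.split => a.
      rewrite !mulmx_block !(mulmx0, mul0mx, addr0, add0r).
      by rewrite /S !star_cube opp_block_mx oppr0.
    rewrite !mulmx_block !(mulmx0, mul0mx, addr0, add0r).
    rewrite !(mulmxN, mulNmx) !mul_delta_mx opprK.
    by rewrite opp_block_mx opprK oppr0.
  + move=> k; rewrite /Br; case: fintype.split => a.
      rewrite !mulmx_block !(mulmx0, mul0mx, addr0, add0r, mulNmx, mulmxN, opprK).
      by rewrite /S !star_cube opp_block_mx oppr0 opprK.
    rewrite !mulmx_block !(mulmx0, mul0mx, addr0, add0r).
    by rewrite /S !star_cube opp_block_mx oppr0.
  + move=> W sl sr; apply: (@quaternionic_irreducible R r W a0 a1) => //.
    * move=> a; have := sl (lshift r a); rewrite /Bl (unsplitK (inl a)).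
      by rewrite /qmx !oppr0 block_mx0.
    * have := sl (rshift r a0); rewrite /Bl (unsplitK (inr a0)).
      by rewrite /qmx !oppr0 block_mx0.
    * move=> a; have := sr (lshift r a); rewrite /Br (unsplitK (inl a)).
      by rewrite /qmx !oppr0 block_mx0.
    * move=> a; have := sr (rshift r a); rewrite /Br (unsplitK (inr a)).
      by rewrite /qmx !oppr0 block_mx0.
(* The second and third metrics share a block: its diagonal entry sees only [1%:M], the entry
   between the two halves only [Om]. *)
- have Om11 : Om (lshift r a0) (lshift r a0) = 0 by rewrite /Om block_mxEul mxE.
  have Om12 : Om (lshift r a0) (rshift r a0) = 1.
    by rewrite /Om block_mxEur mxE eqxx.
  clearbody Om; move=> a /(_ 0).
  rewrite !big_ord_recl big_ord0 /= addr0 trmx1.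
  rewrite !scale_block_mx !add_block_mx !scaler0 !(addr0, add0r) -block_mx0.
  move=> /eq_block_mx[/matrixP/(_ (lshift r a0) (lshift r a0)) e0 /matrixP e1 _ _].
  move: (e1 (lshift r a0) (lshift r a0)) (e1 (lshift r a0) (rshift r a0)) e0.
  rewrite !mxE Om11 Om12 eqxx eq_lrshift !mulr1 !mulr0.
  rewrite addr0 add0r => e1' e2 e0.
  by case=> [[|[|[|//]]]] lti; [rewrite -e0|rewrite -e1'|rewrite -e2];
    congr a; exact: val_inj.
- case=> [[|[|[|//]]]] lti /=.
  + by have [? ?] := @re_metric R (r + r); do !split=> //; exact: re_metric_parallel.
  + have [|? ?] := @im_metric R (r + r) 1%:M; first by rewrite trmx1 mulmx1.
    do !split=> //; apply: im_metric_parallel => // a;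
      by rewrite ?trmx1 ?mulmx1 ?mul1mx.
  + have [? ?] := im_metric OmOm.
    have BrO k : Br k *m Om = - Om *m Br k.
      rewrite /Br /Om; case: fintype.split => a; rewrite opp_block_mx !mulmx_block;
        by rewrite !(mulmx0, mul0mx, addr0, add0r, oppr0, mulmxN, mulNmx, mulmx1,
                     mul1mx, opprK).
    do !split=> //; apply: im_metric_parallel => // k.
    * rewrite /Bl /Om; case: fintype.split => a; rewrite !mulmx_block;
        by rewrite !(mulmx0, mul0mx, addr0, add0r, mulmxN, mulNmx, mulmx1, mul1mx).
    * by rewrite OmT BrO.
    * by rewrite OmT mulmxN BrO mulNmx opprK.
Qed.
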